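(* Let $(S,m)$ be an Artin system with set of labels $L=L(S,m)$, and let $\phi:S'\to S''$ be a label-preserving bijection between two subsets $S',S''\subseteq S$. Then the Artin HNN-extension $G(S,m,\phi)$ has a finite-index subgroup that is isomorphic to a subgroup of an Artin group $A(T,n)$ whose set of labels is $L(T,n)=L\cup\{2,\infty\}$. Likewise, the Coxeter HNN-extension $C(S,m,\phi)$ has a finite-index subgroup that is isomorphic to a subgroup of a Coxeter group $W(T',n')$ with $L(T',n')=L\cup\{2,\infty\}$. In particular, if $(S,m)$ is right-angled (i.e. $L\subseteq\{2,\infty\}$), then $G(S,m,\phi)$ (resp. $C(S,m,\phi)$) has a finite-index subgroup embedding in a right-angled Artin (resp. Coxeter) group.
   Context: An Artin system is a finite set $S$ with a function $m$ from the 2-element subsets of $S$ to $\{2,3,4,\dots\}\cup\{\infty\}$. The Artin group $A(S,m)$ has generators $S$ and, for each pair $s\ne t$ with $m(s,t)<\infty$, the relation $sts\cdots=tst\cdots$ with $m(s,t)$ letters on each side. The Coxeter group $W(S,m)$ has these relations together with $s^2=1$ for all $s\in S$. The set of labels $L(S,m)$ is the image of $m$. The system is right-angled if $L(S,m)\subseteq\{2,\infty\}$. A bijection $\phi:S'\to S''$ between subsets of $S$ is label-preserving if $m(s,s')=m(\phi(s),\phi(s'))$ for all distinct $s,s'\in S'$. The Artin HNN-extension $G(S,m,\phi)$ (resp. Coxeter HNN-extension $C(S,m,\phi)$) is the free product of $A(S,m)$ (resp. $W(S,m)$) with an infinite cyclic group $\langle t\rangle$ modulo the relations $t^{-1}st=\phi(s)$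 for all $s\in S'$; its set of labels is $L(S,m)$. *)

(* Defs.v *)
(* Groups given by presentations, encoded concretely as
   words in generators and their inverses, modulo the congruence generated
   by the relations and free cancellation. *)
From HB Require Import structures.
From mathcomp Require Import all_boot.
Set Implicit Arguments. Unset Strict Implicit. Unset Printing Implicit Defensive.

(* A letter (x, false) is the generator x, (x, true) is x^-1. *)
Definition word (X : Type) := list (X * bool).

Definition winv {X : Type} (w : word X) : word X :=
  rev (map (fun p => (p.1, ~~ p.2)) w).

(* The congruence on words defining the group < X | u = v for R u v >. *)
Inductive weq {X : Type} (R : word X -> word X -> Prop) : word X -> word X -> Prop :=
  | weq_refl u : weq R u u
  | weq_sym u v : weq R u v -> weq R v u
  | weq_trans u v w : weq R u v -> weq R v w -> weq R u w
  | weq_rel u v : R u v -> weq R u v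
  | weq_cancel x b : weq R [:: (x, b); (x, ~~ b)] [::]
  | weq_cat u u' v v' : weq R u u' -> weq R v v' -> weq R (u ++ v) (u' ++ v').

Definition is_subgroup {X : Type} (R : word X -> word X -> Prop)
    (H : word X -> Prop) : Prop :=
  [/\ H [::],
      (forall u v, H u -> H v -> H (u ++ v)),
      (forall u, H u -> H (winv u)) &
      (forall u v, weq R u v -> H u -> H v)].

Definition finite_index {X : Type} (R : word X -> word X -> Prop)
    (H : word X -> Prop) : Prop :=
  is_subgroup R H /\
  exists (k : nat) (reps : 'I_k -> word X),
    forall w, exists i h, H h /\ weq R w (reps i ++ h).

Definition embeds_into {X Y : Type} (R : word X -> word X -> Prop)
    (H : word X -> Prop) (R' : word Y -> word Y -> Prop) : Prop :=
  exists f : word X -> word Y,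
    [/\ (forall u v, H u -> H v -> weq R u v -> weq R' (f u) (f v)),
        (forall u v, H u -> H v -> weq R' (f (u ++ v)) (f u ++ f v)) &
        (forall u v, H u -> H v -> weq R' (f u) (f v) -> weq R u v)].

(* m s t = Some k means m(s,t) = k, None means m(s,t) = infinity.
   Only values at s <> t are meaningful. *)
Definition artin_system (S : finType) (m : S -> S -> option nat) : Prop :=
  (forall s t, s != t -> m s t = m t s) /\
  (forall s t, s != t -> if m s t is Some k then 2 <= k else true).

Definition is_label (S : finType) (m : S -> S -> option nat) (l : option nat) : Prop :=
  exists s t, s != t /\ m s t = l.

Fixpoint alt {S : Type} (s t : S) (k : nat) : word S :=
  if k is k'.+1 then (s, false) :: alt t s k' else [::].

Definition artin_rel (S : finType) (m : S -> S -> option nat) (u v : word S) : Prop :=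
  exists s t k, [/\ s != t, m s t = Some k, u = alt s t k & v = alt t s k].

Definition coxeter_rel (S : finType) (m : S -> S -> option nat) (u v : word S) : Prop :=
  artin_rel m u v \/ exists s, u = [:: (s, false); (s, false)] /\ v = [::].

Definition label_preserving (S : finType) (m : S -> S -> option nat)
    (S' S'' : {set S}) (phi : S -> S) : Prop :=
  [/\ {in S' &, injective phi}, phi @: S' = S'' &
      (forall s s', s \in S' -> s' \in S' -> s != s' -> m (phi s) (phi s') = m s s')].

(* HNN-extension: generators Some s (s in S) and None (= t). *)
Definition lift_word {S : Type} (w : word S) : word (option S) :=
  map (fun p => (Some p.1, p.2)) w.

Definition hnn_rel (S : Type) (base : word S -> word S -> Prop)
    (S' : S -> Prop) (phi : S -> S) (u v : word (option S)) : Prop :=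
  (exists u0 v0, [/\ base u0 v0, u = lift_word u0 & v = lift_word v0]) \/
  (exists s, [/\ S' s, u = [:: (None, true); (Some s, false); (None, false)]
                & v = [:: (Some (phi s), false)]]).

Definition artin_hnn_rel (S : finType) (m : S -> S -> option nat)
    (S' : {set S}) (phi : S -> S) :=
  hnn_rel (artin_rel m) (fun s => s \in S') phi.

Definition coxeter_hnn_rel (S : finType) (m : S -> S -> option nat)
    (S' : {set S}) (phi : S -> S) :=
  hnn_rel (coxeter_rel m) (fun s => s \in S') phi.

(* Main.v *)
(* The stable letter is unrolled around a finite cycle.  Extend [phi] to a permutation
   [p] of [S] and let [N] be twice the order of [p].  There are a finite Artin system
   and [N] label-preserving copies [emb i], [i] in Z/N, of [S] in it, glued along
   [emb i s = emb (i + 1) (phi s)] for [s] in [S']; add for each [i] a generator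
   [tau_i] commuting with [emb i S'].  The words whose [t]-exponent is divisible by [N]
   map to the resulting group by reading [s] at position [i] as [emb i s] and [t] at
   position [i] as [tau_i].

   Injectivity comes from an action of the target group on (HNN group) x Z/N x (Coxeter
   group of the glued system) in which the image of a word [w] sends [(h, 0, 1)] to
   [(h * w, 0, 1)].  There [tau_i] only exchanges [(h, i, 1)] and [(h * t, i + 1, 1)],
   hence may be of order two or not.  A generator of the glued system moves the minimal
   representative [d] of a right coset of the parabolic subgroup of [emb i S] along the
   Schreier graph, and at a loop (when [d r d^-1 = emb i s]) it multiplies [h] by [s].
   That this is an action is a Charney-Paris style proof that parabolic subgroups of
   Artin groups embed.  It rests on the exact order of the products [s t] in a Coxeter
   group, read off the geometric representation, and on the exchange condition, obtained
   from Bourbaki's signed action on reflections. *)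
Require Import Defs.
From HB Require Import structures.
From mathcomp Require Import all_boot all_algebra all_fingroup all_field.
From mathcomp Require Import boolp ring zify.
Set Implicit Arguments. Unset Strict Implicit. Unset Printing Implicit Defensive.

Local Open Scope group_scope.

(** * Presented groups *)

Section Words.
Variables (X : Type) (R : word X -> word X -> Prop).

Lemma winv_cons p (w : word X) : winv (p :: w) = winv w ++ [:: (p.1, ~~ p.2)].
Proof. by rewrite /winv /= rev_cons -cats1. Qed.

Lemma winvK : involutive (@winv X).
Proof.
move=> w; rewrite /winv map_rev revK -map_comp -[RHS]map_id.
by apply: eq_map => -[x b] /=; rewrite negbK.
Qed.

Lemma weq_mulwV w : weq R (w ++ winv w) [::].
Proof.
elim: w => [|[x b] w IHw]; first exact: weq_refl.
rewrite winv_cons /= catA -cat1s.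
apply: weq_trans (weq_cancel R x b).
have -> : [:: (x, b); (x, ~~ b)] = [:: (x, b)] ++ ([::] ++ [:: (x, ~~ b)]) by [].
by apply: weq_cat; [exact: weq_refl|apply: weq_cat => //; exact: weq_refl].
Qed.

Lemma weq_mulVw w : weq R (winv w ++ w) [::].
Proof. by rewrite -{2}[w]winvK; apply: weq_mulwV. Qed.

Lemma weq_winv u v : weq R u v -> weq R (winv u) (winv v).
Proof.
move=> Ruv; rewrite -[winv u]cats0.
apply: (@weq_trans _ _ _ (winv u ++ (v ++ winv v))).
  by apply: weq_cat; [exact: weq_refl|apply/weq_sym/weq_mulwV].
rewrite catA -[X in weq _ _ X]cat0s; apply: weq_cat; last exact: weq_refl.
apply: (@weq_trans _ _ _ (winv u ++ u)); last exact: weq_mulVw.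
by apply: weq_cat; [exact: weq_refl|apply: weq_sym].
Qed.

End Words.

Section Run.
Variables (X O : Type) (act : X -> bool -> O -> O).

Definition run (w : word X) (o : O) : O := foldl (fun o p => act p.1 p.2 o) o w.

Lemma run_cons x b w o : run ((x, b) :: w) o = run w (act x b o).
Proof. by []. Qed.

Lemma run_cat u v o : run (u ++ v) o = run v (run u o).
Proof. exact: foldl_cat. Qed.

Lemma run_weq (R : word X -> word X -> Prop) :
  (forall x b o, act x (~~ b) (act x b o) = o) ->
  (forall u v, R u v -> forall o, run u o = run v o) ->
  forall u v, weq R u v -> forall o, run u o = run v o.
Proof.
move=> actK actR u v; elim=> {u v}.
- by [].
- by move=> u v _ IHu o; rewrite IHu.
- by move=> u v w _ IHu _ IHv o; rewrite IHu.
- exact: actR.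
- by move=> x b o /=; rewrite actK.
- by move=> u u' v v' _ IHu _ IHv o; rewrite !run_cat IHu IHv.
Qed.

End Run.

Section Presented.
Variables (X : choiceType) (R : word X -> word X -> Prop).

Definition weqb (u v : word X) : bool := `[< weq R u v >].

Lemma weqb_equiv : equiv_class_of weqb.
Proof.
split=> [u|u v|v u w].
- exact/asboolP/weq_refl.
- by apply/asboolP/asboolP; exact: weq_sym.
- by move=> /asboolP uv /asboolP vw; apply/asboolP; exact: weq_trans uv vw.
Qed.

Canonical weqb_equiv_rel := EquivRelPack weqb_equiv.

Definition presented := {eq_quot weqb}%qT.

HB.instance Definition _ := Choice.on presented.

Definition cls (w : word X) : presented := \pi_(presented)%qT w.

Lemma clsP u v : cls u = cls v <-> weq R u v.
Proof. by split=> [/eqquotP/asboolP|uv]; last exact/eqquotP/asboolP. Qed.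

Definition word_of (g : presented) : word X := generic_quotient.repr g.

Lemma word_ofK : cancel word_of cls.
Proof. exact: reprK. Qed.

Lemma cls_surj g : exists w, g = cls w.
Proof. by exists (word_of g); rewrite word_ofK. Qed.

Definition pmul (g h : presented) : presented := cls (word_of g ++ word_of h).
Definition pinv (g : presented) : presented := cls (winv (word_of g)).

Lemma weq_word_of w : weq R (word_of (cls w)) w.
Proof. by apply/clsP; rewrite word_ofK. Qed.

Lemma cls_catE u v : pmul (cls u) (cls v) = cls (u ++ v).
Proof. by apply/clsP; apply: weq_cat; exact: weq_word_of. Qed.

Lemma cls_winvE w : pinv (cls w) = cls (winv w).
Proof. exact/clsP/weq_winv/weq_word_of. Qed.

Lemma pmulA : associative pmul.
Proof.
move=> g h k; have [u ->] := cls_surj g; have [v ->] := cls_surj h.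
have [w ->] := cls_surj k.
by rewrite !cls_catE catA.
Qed.

Lemma pmul1g : left_id (cls [::]) pmul.
Proof. by move=> g; have [u ->] := cls_surj g; rewrite cls_catE. Qed.

Lemma pmulg1 : right_id (cls [::]) pmul.
Proof. by move=> g; have [u ->] := cls_surj g; rewrite cls_catE cats0. Qed.

Lemma pmulVg : left_inverse (cls [::]) pinv pmul.
Proof.
by move=> g; have [u ->] := cls_surj g; rewrite cls_winvE cls_catE; apply/clsP/weq_mulVw.
Qed.

Lemma pmulgV : right_inverse (cls [::]) pinv pmul.
Proof.
by move=> g; have [u ->] := cls_surj g; rewrite cls_winvE cls_catE; apply/clsP/weq_mulwV.
Qed.

HB.instance Definition _ := isGroup.Build presented pmulA pmul1g pmulg1 pmulVg pmulgV.

Lemma cls_nil : cls [::] = 1.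
Proof. by []. Qed.

Lemma cls_cat u v : cls (u ++ v) = cls u * cls v.
Proof. by rewrite -cls_catE. Qed.

Definition gen (x : X) : presented := cls [:: (x, false)].

Lemma cls_inv x : cls [:: (x, true)] = (gen x)^-1.
Proof. exact: esym (cls_winvE [:: (x, false)]). Qed.

Lemma cls_cons p w : cls (p :: w) = (if p.2 then (gen p.1)^-1 else gen p.1) * cls w.
Proof. by case: p => x [] /=; rewrite -cat1s cls_cat ?cls_inv. Qed.

Lemma cls_rel u v : R u v -> cls u = cls v.
Proof. by move=> uv; apply/clsP/weq_rel. Qed.

End Presented.
Arguments gen {X} R x.
Arguments cls {X} R w.

Section Alternating.
Variable G : groupType.
Implicit Types (a b : G) (k : nat).

Fixpoint altp a b k : G := if k is k'.+1 then altp a b k' * (if odd k' then b else a) else 1.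

Lemma altpSr a b k : altp a b k.+1 = altp a b k * (if odd k then b else a).
Proof. by []. Qed.

Lemma altpSl a b k : altp a b k.+1 = a * altp b a k.
Proof.
elim: k => [|k IHk]; first by rewrite /= mul1g mulg1.
rewrite -[altp a b k.+2]/(altp a b k.+1 * _) IHk -mulgA; congr (_ * (_ * _)).
by rewrite /=; case: odd.
Qed.

End Alternating.

Lemma cls_alt (X : choiceType) (R : word X -> word X -> Prop) s t k :
  cls R (alt s t k) = altp (gen R s) (gen R t) k.
Proof. 
elim: k s t => [|k IHk] s t //.
by rewrite altpSl -IHk [alt s t _]/= cls_cons.
Qed.

(** * The geometric representation *)

Section GeometricRepresentation.
Import GRing.Theory Num.Theory.
Local Open Scope ring_scope.

(** The term [x_j] of the Chebyshev recursion [x_(j+2) = c x_(j+1) - x_j] with [x_0 = a] and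
    [x_1 = b]. *)
Fixpoint cheb (c a b : algC) (j : nat) : algC :=
  if j is j'.+1 then cheb c b (c * b - a) j' else a.

(** The characteristic roots are [z] and [z^-1]; subtracting [z] times the previous term leaves a
    geometric progression of ratio [z^-1]. *)
Lemma cheb_geom (z a b : algC) j : z != 0 ->
  cheb (z + z^-1) a b j.+1 - z * cheb (z + z^-1) a b j = z ^- j * (b - z * a).
Proof.
move=> z0; elim: j a b => [|j IHj] a b; first by rewrite /= expr0 invr1 mul1r.
rewrite -[cheb _ a b j.+2]/(cheb _ b _ j.+1) -[cheb _ a b j.+1]/(cheb _ b _ j) IHj.
by rewrite exprS; field; rewrite expf_neq0.
Qed.

Lemma cheb_arith (a b : algC) j : cheb 2 a b j = a + (b - a) *+ j.
Proof. by elim: j a b => [|j IHj] a b /=; rewrite ?addr0 ?IHj // mulrS; ring. Qed.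

(** The identities [cheb_geom] for [z] and for [z^-1] form a linear system for two consecutive
    terms, invertible because [z^2 <> 1]. *)
Lemma cheb_half_period (z a b : algC) k : z != 0 -> z ^+ 2 != 1 -> z ^+ k = -1 ->
  cheb (z + z^-1) a b k = - a /\ cheb (z + z^-1) a b k.+1 = - b.
Proof.
move=> z0 z21 zk; have Vz0 : z^-1 != 0 by rewrite invr_eq0.
have:= cheb_geom a b k Vz0; have:= cheb_geom a b k z0.
rewrite invrK [z^-1 + z]addrC exprVn invrK zk invrN1.
set x := cheb _ _ _ k.+1; set y := cheb _ _ _ k => e1 e2.
have zd : z - z^-1 != 0.
  by apply: contra z21; rewrite subr_eq0 => /eqP zV; rewrite expr2 {1}zV mulVf.
have ey : y = - a.
  apply: (mulfI zd); transitivity ((x - z^-1 * y) - (x - z * y)); first by ring.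
  by rewrite e1 e2; ring.
split=> //; transitivity ((x - z * y) + z * y); first by ring.
by rewrite e1 ey; ring.
Qed.

Definition zeta (k : nat) : algC := sval (C_prim_root_exists (ltn0Sn (2 * k).-1%N)).

Lemma zetaP k : (0 < k)%N -> (2 * k).-primitive_root (zeta k).
Proof.
move=> k0; rewrite /zeta; case: C_prim_root_exists => z /=.
by rewrite prednK // muln_gt0.
Qed.

Lemma zeta_neq0 k : (0 < k)%N -> zeta k != 0.
Proof.
move=> k0; have zP := zetaP k0; apply: contraTneq (oner_neq0 algC) => z0.
by rewrite -(prim_expr_order zP) z0 expr0n muln_eq0 /= gtn_eqF // eqxx.
Qed.

Lemma zeta_half k : (0 < k)%N -> zeta k ^+ k = -1.
Proof.
move=> k0; have zP := zetaP k0.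
have: zeta k ^+ k ^+ 2 == 1 by rewrite -exprM mulnC prim_expr_order.
rewrite sqrf_eq1 => /orP[|/eqP//]; rewrite -(prim_order_dvd zP) => /(dvdn_leq k0).
by rewrite mul2n -addnn -{3}[k]addn0 leq_add2l leqNgt k0.
Qed.

Lemma zeta2_neq1 k : (1 < k)%N -> zeta k ^+ 2 != 1.
Proof.
move=> k1; have zP := zetaP (ltnW k1).
by rewrite -(prim_order_dvd zP) gtnNdvd // -{1}[2%N]muln1 ltn_pmul2l.
Qed.

Variables (T : finType) (n : T -> T -> option nat) (n_artin : artin_system n).

(** Up to Galois conjugacy [2 cos (pi / k)], which is minus twice the entry of Tits's bilinear form;
    an infinite label gives the limit value [2]. *)
Definition cox_coef (s t : T) : algC := if n s t is Some k then zeta k + (zeta k)^-1 else 2.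

Lemma cox_coefC s t : s != t -> cox_coef s t = cox_coef t s.
Proof. by move=> st; rewrite /cox_coef n_artin.1. Qed.

Definition geom_refl (s : T) (b : bool) (v : T -> algC) : T -> algC :=
  fun u => if u == s then \sum_(w | w != s) cox_coef s w * v w - v s else v u.

Lemma geom_reflK s b b' v : geom_refl s b' (geom_refl s b v) = v.
Proof.
apply: funext => u; rewrite /geom_refl eqxx; case: eqP => // ->.
rewrite (eq_bigr (fun w => cox_coef s w * v w)) ?subKr // => w /negPf -> //.
Qed.

Definition set2coord (v : T -> algC) s t a b : T -> algC :=
  fun u => if u == s then a else if u == t then b else v u.

Lemma set2coordC v s t a b : s != t -> set2coord v s t a b = set2coord v t s b a.
Proof.
move=> st; apply: funext => u; rewrite /set2coord.
by case: eqP => // ->; rewrite (negPf st).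
Qed.

Lemma geom_refl_set2 v s t b0 a b : s != t ->
  geom_refl s b0 (set2coord v s t a b) =
  set2coord v s t (cox_coef s t * b - a + \sum_(w | (w != s) && (w != t)) cox_coef s w * v w) b.
Proof.
move=> st; apply: funext => u; rewrite /geom_refl /set2coord.
have ts : t != s by rewrite eq_sym.
case: eqP => // _; rewrite eqxx (bigD1 t ts) /= eqxx (negPf ts).
rewrite addrAC; congr (_ - _ + _); apply: eq_bigr => w /andP[/negPf ws /negPf wt].
by rewrite ws wt.
Qed.

(** The hypotheses say that [(fa, fb)] is fixed by both reflections. Measured from it, a reflection
    replaces the older coordinate by [c] times the newer one minus the older, which is the recursion
    of [cheb]. *)
Lemma run_geom_alt v s t fa fb a b j : s != t ->
  let c := cox_coef s t in
  2 * fa = c * fb + \sum_(w | (w != s) && (w != t)) cox_coef s w * v w ->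
  2 * fb = c * fa + \sum_(w | (w != t) && (w != s)) cox_coef t w * v w ->
  run geom_refl (alt s t j) (set2coord v s t (fa + a) (fb + b)) =
  if odd j then set2coord v t s (fb + cheb c a b j) (fa + cheb c a b j.+1)
  else set2coord v s t (fa + cheb c a b j) (fb + cheb c a b j.+1).
Proof.
elim: j s t fa fb a b => [|j IHj] s t fa fb a b st c efa efb //.
rewrite /= -/(run _ _ _) geom_refl_set2 // set2coordC // -/c.
have -> : c * (fb + b) - (fa + a) + \sum_(w | (w != s) && (w != t)) cox_coef s w * v w =
  fa + (c * b - a).
  apply: (addrI (c * fb)); transitivity (2 * fa + (c * fb + c * b - fa - a)).
    by rewrite efa; ring.
  by ring.
have cE : c = cox_coef t s by rewrite /c cox_coefC.
have ts : t != s by rewrite eq_sym.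
rewrite (IHj t s fb fa b (c * b - a) ts) -?cE //.
by case: (odd j).
Qed.

(** Relative to a common fixed point, [k] letters are half a period: both words negate the
    deviation, and exchange its two entries when [k] is odd. *)
Lemma geom_refl_braid s t k v : s != t -> n s t = Some k ->
  run geom_refl (alt s t k) v = run geom_refl (alt t s k) v.
Proof.
move=> st nst; have ts : t != s by rewrite eq_sym.
have k1 : (1 < k)%N by have := n_artin.2 s t st; rewrite nst.
have k0 : (0 < k)%N := ltnW k1.
pose c := cox_coef s t; have cE : c = zeta k + (zeta k)^-1 by rewrite /c /cox_coef nst.
have cE' : c = cox_coef t s by rewrite /c cox_coefC.
have z0 := zeta_neq0 k0.
(* This is the determinant of the linear system for the common fixed point [(fa, fb)]. *)
have c4 : 4 - c ^+ 2 != 0.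
  have -> : 4 - c ^+ 2 = - ((zeta k ^+ 2 - 1) / zeta k) ^+ 2 by rewrite cE; field.
  by rewrite oppr_eq0 expf_neq0 // mulf_neq0 ?invr_neq0 // subr_eq0 zeta2_neq1.
pose A := \sum_(w | (w != s) && (w != t)) cox_coef s w * v w.
pose B := \sum_(w | (w != t) && (w != s)) cox_coef t w * v w.
pose fa := (2 * A + c * B) / (4 - c ^+ 2); pose fb := (2 * B + c * A) / (4 - c ^+ 2).
have efa : 2 * fa = c * fb + A by rewrite /fa /fb; field.
have efb : 2 * fb = c * fa + B by rewrite /fa /fb; field.
have vE : v = set2coord v s t (fa + (v s - fa)) (fb + (v t - fb)).
  apply: funext => u; rewrite /set2coord !subrKC.
  by case: eqP => [->|] //; case: eqP => [->|].
have vE' : v = set2coord v t s (fb + (v t - fb)) (fa + (v s - fa)).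
  by rewrite set2coordC -?vE.
have e1 := run_geom_alt (v s - fa) (v t - fb) k st efa efb.
have efb' : 2 * fb = cox_coef t s * fa + B by rewrite -cE'.
have efa' : 2 * fa = cox_coef t s * fb + A by rewrite -cE'.
have e2 := run_geom_alt (v t - fb) (v s - fa) k ts efb' efa'.
move: e1 e2; rewrite -vE -vE' -cE' -/c cE => -> ->.
have zk := zeta_half k0; have z2 := zeta2_neq1 k1.
have [-> ->] := cheb_half_period (v s - fa) (v t - fb) z0 z2 zk.
have [-> ->] := cheb_half_period (v t - fb) (v s - fa) z0 z2 zk.
by rewrite set2coordC // [in RHS]set2coordC //; case: odd; rewrite // set2coordC.
Qed.

Lemma geom_refl_weq u w : weq (coxeter_rel n) u w -> run geom_refl u =1 run geom_refl w.
Proof.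
apply: run_weq => [x b o|u' w' [[s [t [k [st nst -> ->]]]]|[s [-> ->]]] v].
- exact: geom_reflK.
- exact: geom_refl_braid.
- exact: geom_reflK.
Qed.

Lemma coxeter_order s t j : s != t -> (0 < j)%N ->
  (altp (gen (coxeter_rel n) s) (gen (coxeter_rel n) t) (2 * j)%N = 1)%g ->
  exists k, n s t = Some k /\ (k %| j)%N.
Proof.
move=> st j0; rewrite -cls_alt -cls_nil => /clsP/geom_refl_weq.
(* The test vector is the simple root of [t], and the common fixed point is [0]; the coordinates
   after [2 * j] letters are terms of [cheb] started at [0, 1]. *)
move=> /(_ (set2coord (fun=> 0) s t (0 + 0) (0 + 1))).
have sum0 (P : pred T) d : \sum_(w | P w) d w * ((fun=> 0) w : algC) = 0.
  by rewrite big1 // => w _; rewrite mulr0.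
rewrite run_geom_alt //; [|by rewrite sum0 !mulr0 addr0 ..].
rewrite oddM /= => /(congr1 (fun f => (f s, f t))).
rewrite /set2coord !eqxx [t == s]eq_sym (negPf st) !add0r => -[e0 e1].
case nst: (n s t) => [k|]; last first.
  move: e0; rewrite /cox_coef nst cheb_arith add0r subr0 => /eqP.
  by rewrite pnatr_eq0 muln_eq0 /= -leqn0 leqNgt j0.
have k1 : (1 < k)%N by have := n_artin.2 s t st; rewrite nst.
have k0 : (0 < k)%N := ltnW k1.
exists k; split=> //; have zP := zetaP k0; have z0 := zeta_neq0 k0.
have /= := cheb_geom 0 1 (2 * j) z0; move: e0 e1; rewrite /cox_coef nst => -> ->.
rewrite mulr0 subr0 mulr1 => /esym/eqP; rewrite invr_eq1 -(prim_order_dvd zP).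
by rewrite dvdn_pmul2l.
Qed.

End GeometricRepresentation.

(** * Alternating products *)

Lemma alt_cat (X : Type) (s t : X) p q :
  alt s t (p + q) = alt s t p ++ (if odd p then alt t s q else alt s t q).
Proof. by elim: p s t => [|p IHp] s t //=; rewrite IHp; case: odd. Qed.

Section Dihedral.
Variable G : groupType.
Implicit Types a b : G.

Lemma altp_cat a b p q :
  altp a b (p + q) = altp a b p * (if odd p then altp b a q else altp a b q).
Proof.
elim: p a b => [|p IHp] a b; first by rewrite mul1g.
by rewrite addSn !altpSl IHp -mulgA /=; case: odd.
Qed.

Lemma altpM_inv a b p : a * a = 1 -> b * b = 1 ->
  altp a b p * (if odd p then altp a b p else altp b a p) = 1.
Proof.
move=> aa bb; elim: p => [|p IHp]; first by rewrite mulg1.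
rewrite [altp a b p.+1 in X in X * _]/= !altpSl [odd p.+1]/=.
case: (odd p) IHp => /= IHp; first by rewrite -mulgA [b * (b * _)]mulgA bb mul1g.
by rewrite -mulgA [a * (a * _)]mulgA aa mul1g.
Qed.

Lemma altpV a b p : a * a = 1 -> b * b = 1 ->
  (altp a b p)^-1 = if odd p then altp a b p else altp b a p.
Proof. by move=> aa bb; apply: mulg1_eq; rewrite altpM_inv. Qed.

Lemma altp_odd a b p : a * a = 1 -> b * b = 1 ->
  (if odd p then b else a) ^ (altp a b p)^-1 = altp a b (2 * p).+1%N.
Proof.
move=> aa bb; rewrite conjgE invgK mulgA altpV //.
rewrite -[altp a b p * _]/(altp a b p.+1) mul2n -addnn -addSn altp_cat /=.
by case: odd.
Qed.

Lemma altp_full a b k : a * a = 1 -> b * b = 1 -> altp a b k = altp b a k ->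
  altp a b (2 * k)%N = 1.
Proof.
move=> aa bb braid.
by rewrite mul2n -addnn altp_cat -braid -[RHS](altpM_inv k aa bb) -braid; case: odd.
Qed.

Lemma altp_mod a b k p : altp a b (2 * k)%N = 1 -> altp a b (p %% (2 * k)) = altp a b p.
Proof.
move=> full; rewrite [in RHS](divn_eq p (2 * k)); elim: (p %/ _) => [|q IHq] //.
by rewrite [(q.+1 * _)%N]mulSn -addnA altp_cat full oddM /= mul1g.
Qed.

(** The alternating walk closes up after [2 * k] steps, so going round it backwards replaces [p] by
    [2 * k - p]. *)
Lemma altp_swap a b k p : a * a = 1 -> b * b = 1 -> altp a b (2 * k)%N = 1 ->
  p <= (2 * k)%N -> altp b a p = altp a b (2 * k - p)%N.
Proof.
move=> aa bb full le_p; move: full; rewrite -{1}(subnK le_p) altp_cat oddB // oddM /=.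
move=> /(canRL (mulgK _)) ->; rewrite mul1g.
by case: ifP => p_odd; rewrite altpV // p_odd.
Qed.

End Dihedral.

(** * The reflection cocycle of a Coxeter group *)

Section Coxeter.
Variables (T : finType) (n : T -> T -> option nat) (n_artin : artin_system n).

Notation W := (presented (coxeter_rel n)).
Notation g := (gen (coxeter_rel n)).
Implicit Types (s t x : T) (w r u d : W).

Lemma gen_sqr s : g s * g s = 1.
Proof. by rewrite -cls_cat -cls_nil; apply: cls_rel; right; exists s. Qed.

Lemma genV s : (g s)^-1 = g s.
Proof. by apply: mulg1_eq; rewrite gen_sqr. Qed.

Lemma mulg_genK s w : w * g s * g s = w.
Proof. by rewrite -mulgA gen_sqr mulg1. Qed.

Lemma gen_braid s t k : s != t -> n s t = Some k ->
  altp (g s) (g t) k = altp (g t) (g s) k.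
Proof.
by move=> st nst; rewrite -!cls_alt; apply: cls_rel; left; exists s, t, k.
Qed.

Lemma label_sym s t k : s != t -> n s t = Some k -> n t s = Some k.
Proof. by move=> st; rewrite n_artin.1. Qed.

Lemma label_gt1 s t k : s != t -> n s t = Some k -> 1 < k.
Proof. by move=> st nst; have := n_artin.2 s t st; rewrite nst. Qed.

Lemma altp_eq1 s t k j : s != t -> n s t = Some k ->
  (altp (g s) (g t) (2 * j)%N == 1) = (k %| j).
Proof.
move=> st nst; apply/eqP/idP => [|/dvdnP[q ->]].
  case: j => [|j] // /(coxeter_order n_artin st (ltn0Sn j)) [k' []].
  by rewrite nst => -[->].
rewrite mulnCA -(altp_mod _ (altp_full (gen_sqr s) (gen_sqr t) (gen_braid st nst))).
by rewrite modnMl.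
Qed.

Lemma gen_inj : injective g.
Proof.
move=> s t gst; apply/eqP; apply: contraT => st.
have: altp (g s) (g t) (2 * 1)%N = 1 by rewrite /= mul1g gst gen_sqr.
move=> /(coxeter_order n_artin st (ltn0Sn 0)) [k [nst k1]].
by have := label_gt1 st nst; move: k1; rewrite dvdn1 => /eqP ->.
Qed.

Definition wprod (l : seq T) : W := foldr (fun s w => g s * w) 1 l.

Lemma wprod_cat l1 l2 : wprod (l1 ++ l2) = wprod l1 * wprod l2.
Proof. by elim: l1 => [|s l1 IHl] /=; rewrite ?mul1g // IHl mulgA. Qed.

Lemma wprodV l : (wprod l)^-1 = wprod (rev l).
Proof.
elim: l => [|s l IHl] /=; first by rewrite invg1.
by rewrite invgM IHl rev_cons -cats1 wprod_cat /= mulg1 genV.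
Qed.

Lemma wprod_surj w : exists l, w = wprod l.
Proof.
have [v ->] := cls_surj w; exists (map fst v).
by elim: v => [|[s b] v IHv] //=; rewrite cls_cons /= genV if_same IHv.
Qed.

(** Bourbaki's signed permutation action, with the sign as a boolean and extended from the
    reflections to all elements of [W]. *)
Definition refl_act (s : T) (b : bool) (p : W * bool) : W * bool :=
  (p.1 ^ g s, p.2 (+) (p.1 == g s)).

Lemma conj_gen_eq s r u : (r ^ g s == u) = (r == u ^ g s).
Proof.
by apply/eqP/eqP => [<-|->]; rewrite -conjgM gen_sqr conjg1.
Qed.

Lemma refl_actK s b b' p : refl_act s b' (refl_act s b p) = p.
Proof.
case: p => r e; rewrite /refl_act /= -conjgM gen_sqr conjg1 -addbA.
by rewrite conj_gen_eq conjgE gen_sqr mulg1 genV addbb addbF.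
Qed.

Lemma run_refl_alt s t k r e :
  run refl_act (alt s t k) (r, e) =
  (r ^ altp (g s) (g t) k,
   e (+) \big[addb/false]_(i < k) (r == altp (g s) (g t) (2 * i).+1%N)).
Proof.
elim: k s t r e => [|k IHk] s t r e; first by rewrite big_ord0 addbF conjg1.
rewrite [LHS]/= -/(run _ _ _) IHk altpSl -conjgM big_ord_recl addbA.
congr (_, _ (+) _); first by rewrite /= mul1g.
apply: eq_bigr => i _; rewrite conj_gen_eq conjgE genV.
by rewrite lift0 mulnS [in RHS]altpSl /= oddM.
Qed.

Lemma refl_act_braid s t k p : s != t -> n s t = Some k ->
  run refl_act (alt s t k) p = run refl_act (alt t s k) p.
Proof.
move=> st nst; case: p => r e; rewrite !run_refl_alt (gen_braid st nst).
(* The palindromes of odd length below [2 * k] starting with [s] are those starting with [t] in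
   reverse order. *)
congr (_, _ (+) _); rewrite [RHS](reindex_inj rev_ord_inj).
apply: eq_bigr => i _; congr (_ == _).
have full := altp_full (gen_sqr t) (gen_sqr s) (esym (gen_braid st nst)).
have ltik := ltn_ord i.
rewrite (altp_swap (gen_sqr t) (gen_sqr s) full); last by lia.
by have -> : (2 * k - (2 * i).+1 = (2 * rev_ord i).+1)%N by rewrite /=; lia.
Qed.

Lemma refl_act_weq (v1 v2 : word T) :
  weq (coxeter_rel n) v1 v2 -> run refl_act v1 =1 run refl_act v2.
Proof.
apply: run_weq => [x b o|u' w' [[s [t [k [st nst -> ->]]]]|[s [-> ->]]] p].
- exact: refl_actK.
- exact: refl_act_braid.
- exact: refl_actK.
Qed.

(* Sign of the reflection cocycle: for a reflection [r], [linv w r] says that [r] is a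
   left inversion of [w]. *)
Definition linv w r : bool := (run refl_act (word_of w) (r, false)).2.

Lemma run_refl_act v r e : run refl_act v (r, e) = (r ^ cls _ v, e (+) linv (cls _ v) r).
Proof.
have shift v' r' e' : run refl_act v' (r', e') =
    (r' ^ cls _ v', e' (+) (run refl_act v' (r', false)).2).
  elim: v' r' e' => [|[s b] v' IHv] r' e'; first by rewrite conjg1 addbF.
  rewrite [LHS]/= -/(run _ _ _) [run _ (_ :: _) _ in RHS]/= -/(run _ _ _).
  by rewrite [in LHS]IHv [in RHS]IHv /= cls_cons /= genV if_same conjgM addbA.
by rewrite shift /linv (refl_act_weq (weq_word_of _ v)).
Qed.

Lemma linvM u w r : linv (u * w) r = linv u r (+) linv w (r ^ u).
Proof.
have [v1 ->] := cls_surj u; have [v2 ->] := cls_surj w.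
have := run_refl_act (v1 ++ v2) r false.
by rewrite run_cat !run_refl_act cls_cat => -[_ ->].
Qed.

Lemma linv_gen s r : linv (g s) r = (r == g s).
Proof. by have /(congr1 snd) /= <- := run_refl_act [:: (s, false)] r false. Qed.

Lemma linv1 r : linv 1 r = false.
Proof. by have /(congr1 snd) /= <- := run_refl_act [::] r false. Qed.

Lemma linvV u r : linv u^-1 (r ^ u) = linv u r.
Proof. by have := linvM u u^-1 r; rewrite mulgV linv1; case: linv; case: linv. Qed.

Lemma linv_altp s t k r :
  linv (altp (g s) (g t) k) r =
  \big[addb/false]_(i < k) (r == altp (g s) (g t) (2 * i).+1%N).
Proof.
rewrite -cls_alt; have /(congr1 snd) /= := run_refl_act (alt s t k) r false.
by rewrite run_refl_alt.
Qed.

(** By the cocycle rule, [r] conjugated by some prefix of [l] is the next letter; multiplying by [r]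
    deletes that letter. *)
Lemma exchange l r : linv (wprod l) r ->
  exists l', size l' < size l /\ r * wprod l = wprod l'.
Proof.
elim: l r => [|s l IHl] r /=; first by rewrite linv1.
rewrite linvM linv_gen; case: eqP => [-> _|_ /IHl[l' [szl' e]]].
  by exists l; rewrite ltnSn mulgA gen_sqr mul1g.
exists (s :: l'); split=> //=; rewrite -e conjgE genV.
by rewrite !mulgA gen_sqr mul1g.
Qed.

End Coxeter.

(** * Dihedral subgroups and minimal representatives of their cosets *)

Section CoxeterDihedral.
Variables (T : finType) (n : T -> T -> option nat) (n_artin : artin_system n).
Notation W := (presented (coxeter_rel n)).
Notation g := (gen (coxeter_rel n)).
Implicit Types (s t x : T) (w r u d : W).

(** The palindrome of length [1] is [g s]; a longer one equal to it would make [(s t)^i] trivial for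
    some [0 < i < k]. *)
Lemma linv_altp_first s t k q : s != t -> n s t = Some k -> 0 < q <= k ->
  linv (altp (g s) (g t) q) (g s).
Proof.
move=> st nst; rewrite linv_altp; case: q => // q /= le_qk.
rewrite big_ord_recl mul1g eqxx big1 // => i _.
apply/negbTE/negP; rewrite lift0 altpSr oddM /= => /eqP e.
have: altp (g s) (g t) (2 * i.+1)%N == 1.
  by apply/eqP/(@mulIg _ (g s)); rewrite mul1g -e.
rewrite (altp_eq1 n_artin _ st nst) => /(dvdn_leq (ltn0Sn i)).
by have := ltn_ord i; lia.
Qed.

Variables (s t : T) (k : nat).
Hypotheses (st : s != t) (nst : n s t = Some k).

Let ts : t != s. Proof. by rewrite eq_sym. Qed.
Let nts : n t s = Some k. Proof. exact (label_sym n_artin st nst). Qed.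
Let full : altp (g s) (g t) (2 * k)%N = 1.
Proof. exact: altp_full (gen_sqr n s) (gen_sqr n t) (gen_braid st nst). Qed.
Let k_gt0 : 0 < k. Proof. exact: ltnW (label_gt1 n_artin st nst). Qed.

(** As the label is finite, a word starting with [t] is also one starting with [s], going round the
    cycle. *)
Definition in_dihedral u := exists p, u = altp (g s) (g t) p.

Lemma in_dihedral1 : in_dihedral 1.
Proof. by exists 0. Qed.

Lemma in_dihedralMl u : in_dihedral u -> in_dihedral (u * g s).
Proof.
move=> [[|p] ->]; last first.
  case p_odd: (odd p); [exists p.+2|exists p].
    by rewrite [RHS]altpSr oddS p_odd.
  by rewrite altpSr p_odd -mulgA gen_sqr mulg1.
by exists 1%N; rewrite altpSr.
Qed.

Lemma in_dihedralMr u : in_dihedral u -> in_dihedral (u * g t).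
Proof.
move=> [[|p] ->]; last first.
  case p_odd: (odd p); [exists p|exists p.+2].
    by rewrite altpSr p_odd -mulgA gen_sqr mulg1.
  by rewrite [RHS]altpSr oddS p_odd.
(* [g t] itself is the alternating word of length [2 * k - 1] starting with [s]. *)
exists (2 * k - 1)%N; rewrite -(altp_swap (gen_sqr n s) (gen_sqr n t) full); last by lia.
by [].
Qed.

Lemma in_dihedralM u1 u2 : in_dihedral u1 -> in_dihedral u2 -> in_dihedral (u1 * u2).
Proof.
move=> D1 [p ->]; elim: p => [|p IHp]; first by rewrite mulg1.
by rewrite /= mulgA; case: odd; [apply: in_dihedralMr|apply: in_dihedralMl].
Qed.

Lemma in_dihedral_gen : in_dihedral (g s) /\ in_dihedral (g t).
Proof.
by split; rewrite -[g _]mul1g; [apply: in_dihedralMl|apply: in_dihedralMr]; apply: in_dihedral1.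
Qed.

Lemma in_dihedralV u : in_dihedral u -> in_dihedral u^-1.
Proof.
have [Ds Dt] := in_dihedral_gen.
move=> [p ->]; elim: p => [|p IHp]; first by rewrite invg1; exact: in_dihedral1.
by rewrite /= invgM; apply: in_dihedralM => //; case: odd; rewrite genV.
Qed.

Lemma in_dihedral_normal u : in_dihedral u ->
  (exists2 i, i < k & u = altp (g s) (g t) i) \/
  (exists2 q, 0 < q <= k & u = altp (g t) (g s) q).
Proof.
move=> [p ->]; rewrite -(altp_mod p full).
have: p %% (2 * k) < 2 * k by rewrite ltn_mod muln_gt0.
set i := p %% _; move=> lt_i; case: (ltnP i k) => [lt_ik|le_ki].
  by left; exists i.
right; exists (2 * k - i)%N; first by lia.
rewrite (altp_swap (gen_sqr n s) (gen_sqr n t) full); last by lia.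
by rewrite subKn // ltnW.
Qed.

Lemma in_dihedral_path u : in_dihedral u -> linv u (g t) = false ->
  exists2 i, i < k & u = altp (g s) (g t) i.
Proof.
move=> /in_dihedral_normal[//|[q q_bd ->]].
by rewrite (linv_altp_first ts nts q_bd).
Qed.

Lemma in_dihedral_eq1 u : in_dihedral u -> linv u (g s) = false -> linv u (g t) = false ->
  u = 1.
Proof.
move=> Du us /(in_dihedral_path Du)[[//|i] lt_ik e]; move: us.
by rewrite e (linv_altp_first st nst) //= ltnW.
Qed.

(** Take [d0] of minimal word length in [d D], where [D] is the dihedral subgroup; a left inversion
    of [d0^-1] in [D] would give, by exchange, a shorter element of the same coset. *)
Lemma dihedral_min_rep d : exists d0 u,
  [/\ d = d0 * u, in_dihedral u & forall r, in_dihedral r -> linv d0^-1 r = false].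
Proof.
pose P p := `[< exists l u, [/\ size l = p, in_dihedral u & d * u = wprod n l] >].
have exP : exists p, P p.
  have [l dl] := wprod_surj d; exists (size l); apply/asboolP; exists l, 1.
  by split; [|exact: in_dihedral1|rewrite mulg1].
case: (ex_minnP exP) => p /asboolP[l [u [szl Du e]]] p_min.
exists (d * u), u^-1; split; [by rewrite mulgK|exact: in_dihedralV|].
move=> r Dr; apply/negbTE/negP; rewrite e wprodV => /exchange[l'].
rewrite size_rev -wprodV -e => -[lt_l' e'].
suff /p_min : P (size l') by lia.
apply/asboolP; exists (rev l'), (u * r^-1); split; first by rewrite size_rev.
  by apply: in_dihedralM => //; exact: in_dihedralV.
by rewrite -wprodV -e' invgM invgK mulgA.
Qed.

Lemma dihedral_conj_gen d0 r x : (forall r', in_dihedral r' -> linv d0^-1 r' = false) ->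
  in_dihedral r -> r ^ d0^-1 = g x -> r = g s \/ r = g t.
Proof.
move=> d0_min Dr rx; have [Ds Dt] := in_dihedral_gen; have DVr := in_dihedralV Dr.
have r1 : r^-1 <> 1.
  move=> /eqP; rewrite invg_eq1 => /eqP r1; move: rx; rewrite r1 conj1g => x1.
  by have := linv_gen x (g x); rewrite -{1}x1 linv1 eqxx.
(* Compare inversions at [a] of both sides of [r^-1 d0^-1 = d0^-1 x]: by minimality [d0^-1]
   contributes nothing, so [d0 a d0^-1] equals [x], as does [d0 r d0^-1]. A nontrivial [r^-1]
   inverts [s] or [t]. *)
have key a : in_dihedral (g a) -> linv r^-1 (g a) -> r = g a.
  move=> Da ra; apply/esym/(@conjg_inj _ d0^-1)/eqP; rewrite rx.
  have e : r^-1 * d0^-1 = d0^-1 * g x.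
    have -> : g x = r^-1 ^ d0^-1 by rewrite conjVg rx genV.
    by rewrite conjgE invgK mulKg.
  have := congr1 (fun w => linv w (g a)) e; rewrite !linvM ra linv_gen.
  have Dc : in_dihedral (g a ^ r^-1).
    by rewrite conjgE invgK; apply: in_dihedralM => //; exact: in_dihedralM.
  by rewrite (d0_min _ Dc) (d0_min _ Da) => /= <-.
case es: (linv r^-1 (g s)); first by left; apply: key.
case et: (linv r^-1 (g t)); first by right; apply: key.
by case: r1; apply: in_dihedral_eq1.
Qed.

End CoxeterDihedral.

(** * The action on cosets of a parabolic subgroup *)

Section CosetAction.
Variables (T : finType) (n : T -> T -> option nat) (n_artin : artin_system n).
Notation W := (presented (coxeter_rel n)).
Notation g := (gen (coxeter_rel n)).
Variables (S : finType) (f : S -> T) (f_inj : injective f).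
Variables (G : groupType) (gam : S -> G).
Hypothesis gam_braid : forall x y k, x != y -> n (f x) (f y) = Some k ->
  altp (gam x) (gam y) k = altp (gam y) (gam x) k.
Implicit Types (s t : T) (x y : S) (r u d : W) (h : G) (o : G * W).

Definition label r : option S := [pick x | g (f x) == r].

Lemma labelP r x : label r = Some x <-> g (f x) = r.
Proof.
rewrite /label; split=> [|<-]; first by case: pickP => // y /eqP e [<-].
by case: pickP => [y /eqP/(gen_inj n_artin)/f_inj -> //|/(_ x)/eqP].
Qed.

Definition min_rep d : bool := [forall x, ~~ linv d (g (f x))].

Lemma min_rep1 : min_rep 1.
Proof. by apply/forallP => x; rewrite linv1. Qed.

Definition coset_step0 s (b : bool) o : G * W :=
  if label (g s ^ o.2^-1) is Some x then (o.1 * (if b then (gam x)^-1 else gam x), o.2)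
  else (o.1, o.2 * g s).

(* Right action of a generator on the pairs (element of [G], minimal representative of a
   right coset of the parabolic subgroup generated by [f]).  The remaining elements of
   the Coxeter group are junk, on which the generators act trivially. *)
Definition coset_step s (b : bool) o : G * W :=
  if min_rep o.2 then coset_step0 s b o else o.

Lemma coset_step0_loop s b h d x : g (f x) = g s ^ d^-1 ->
  coset_step0 s b (h, d) = (h * (if b then (gam x)^-1 else gam x), d).
Proof. by move=> /labelP e; rewrite /coset_step0 /= e. Qed.

Lemma coset_step0_move s b h d : label (g s ^ d^-1) = None ->
  coset_step0 s b (h, d) = (h, d * g s).
Proof. by rewrite /coset_step0 /= => ->. Qed.

Lemma conj_gen_step s d : g s ^ (d * g s)^-1 = g s ^ d^-1.
Proof. by rewrite invgM genV conjgM [_ ^ g s]conjgE !genV gen_sqr mulg1. Qed.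

Lemma coset_step0K s b o : coset_step0 s (~~ b) (coset_step0 s b o) = o.
Proof.
case: o => h d; case e: (label (g s ^ d^-1)) => [x|].
  move/labelP: e => e; rewrite !(coset_step0_loop _ _ e).
  by case: b; rewrite ?mulgVK ?mulgK.
by rewrite !coset_step0_move ?conj_gen_step // mulg_genK.
Qed.

(** Half of Deodhar's lemma: a left descent in the parabolic subgroup acquired in passing from [d]
    to [d s] equals [d s d^-1], and then the step is a loop, not a move. *)
Lemma min_rep_step0 s b o : min_rep o.2 -> min_rep (coset_step0 s b o).2.
Proof.
case: o => h d /= d_min; case e: (label (g s ^ d^-1)) => [x|].
  by move/labelP: e => e; rewrite (coset_step0_loop _ _ e).
rewrite coset_step0_move //; apply/forallP => x; rewrite linvM linv_gen.
rewrite (negbTE (forallP d_min x)) /=; apply/negP => /eqP ex.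
by move: e; rewrite -ex conjgK; have /labelP -> := erefl (g (f x)).
Qed.

Lemma coset_stepK s b o : coset_step s (~~ b) (coset_step s b o) = o.
Proof.
rewrite {2}/coset_step; case: ifP => o_min; last by rewrite /coset_step o_min.
by rewrite /coset_step min_rep_step0 // coset_step0K.
Qed.

Lemma run_coset_step v o :
  run coset_step v o = if min_rep o.2 then run coset_step0 v o else o.
Proof.
elim: v o => [|[s b] v IHv] o /=; first by rewrite if_same.
rewrite -!/(run _ _ _) IHv /coset_step.
by case: (boolP (min_rep o.2)) => [o_min|/negbTE ->] //; rewrite min_rep_step0.
Qed.

Lemma coset_step_loop x b h : coset_step (f x) b (h, 1) =
  (h * (if b then (gam x)^-1 else gam x), 1).
Proof.
by rewrite /coset_step min_rep1 (@coset_step0_loop _ _ _ _ x) // invg1 conjg1.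
Qed.

(** * The braid relation on an orbit of a dihedral subgroup *)

Section Braid.
Variables (s t : T) (k : nat) (d0 : W).
Hypotheses (st : s != t) (nst : n s t = Some k).
Hypothesis d0_min : forall r, in_dihedral s t r -> linv d0^-1 r = false.
Notation D := (in_dihedral s t).
Notation A := (altp (g s) (g t)).

Let k_gt1 : 1 < k. Proof. exact (label_gt1 n_artin st nst). Qed.
Let full : A (2 * k)%N = 1.
Proof. exact: altp_full (gen_sqr n s) (gen_sqr n t) (gen_braid st nst). Qed.

Lemma label_dihedral r : D r -> r <> g s -> r <> g t -> label (r ^ d0^-1) = None.
Proof.
move=> Dr rs rt; case e: label => [x|] //; move/labelP/esym: e => e.
by case: (dihedral_conj_gen n_artin st nst d0_min Dr e).
Qed.

(** If [u] began with [a], then [d0 u] would begin with the parabolic generator [d0 a d0^-1]. *)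
Lemma label_linv a u x : D (g a) -> label (g a ^ d0^-1) = Some x ->
  min_rep (d0 * u) -> linv u (g a) = false.
Proof.
move=> Da /labelP e /forallP/(_ x); rewrite linvM e conjgKV => /negbTE.
have -> // : linv d0 (g a ^ d0^-1) = false.
by rewrite -linvV conjgKV d0_min.
Qed.

Lemma run_free h u v : label (g s ^ d0^-1) = None -> label (g t ^ d0^-1) = None -> D u ->
  all (fun p => p.1 \in [:: s; t]) v -> run coset_step0 v (h, d0 * u) = (h, d0 * u * cls _ v).
Proof.
move=> ls lt; have [Ds Dt] := in_dihedral_gen n_artin st nst.
elim: v u => [|[a b] v IHv] u Du; first by rewrite mulg1.
move=> /= /andP[a_st v_st].
have Da : D (g a) by move: a_st; rewrite !inE => /orP[]/eqP->.
have Duu : D (g a ^ u^-1).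
  rewrite conjgE invgK; apply: (in_dihedralM n_artin st nst) => //.
  exact: (in_dihedralM n_artin st nst Da (in_dihedralV n_artin st nst Du)).
rewrite -/(run _ _ _) coset_step0_move; last first.
  rewrite invgM conjgM.
  case: (pselect (g a ^ u^-1 = g s)) => [->//|ns].
  by case: (pselect (g a ^ u^-1 = g t)) => [->//|nt]; exact: label_dihedral.
rewrite -mulgA IHv //; last exact: (in_dihedralM n_artin st nst).
by rewrite cls_cons /= genV if_same -!mulgA.
Qed.

Lemma run_both h x y a b j : label (g a ^ d0^-1) = Some x -> label (g b ^ d0^-1) = Some y ->
  run coset_step0 (alt a b j) (h, d0) = (h * altp (gam x) (gam y) j, d0).
Proof.
elim: j a b x y h => [|j IHj] a b x y h lx ly; first by rewrite mulg1.
rewrite altpSl /= -/(run _ _ _); move/labelP: (lx) => ex.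
by rewrite (coset_step0_loop _ _ ex) (IHj _ _ _ _ _ ly lx) mulgA.
Qed.

(** Conjugation by [d0] carries the products of [s] and [t] to those of [f x] and [f y]. Labels are
    exact orders, so the two labels divide each other. *)
Lemma label_both x y : label (g s ^ d0^-1) = Some x -> label (g t ^ d0^-1) = Some y ->
  x != y /\ n (f x) (f y) = Some k.
Proof.
move=> /labelP ex /labelP ey.
have conjA j : altp (g (f x)) (g (f y)) j = A j ^ d0^-1.
  elim: j => [|j IHj]; first by rewrite conj1g.
  by rewrite !altpSr conjMg IHj ex ey; case: odd.
have xy : x != y.
  apply: contra st => /eqP exy; apply/eqP/(gen_inj n_artin)/(@conjg_inj _ d0^-1).
  by rewrite -ex -ey exy.
have fxy : f x != f y by rewrite inj_eq.
have k_gt0 : 0 < k := ltnW k_gt1.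
split=> //; have [k' [nk' k'k]] : exists k', n (f x) (f y) = Some k' /\ k' %| k.
  by apply: (coxeter_order n_artin fxy k_gt0); rewrite conjA full conj1g.
have := altp_eq1 n_artin k' fxy nk'; rewrite conjA conjg_eq1 dvdnn.
rewrite (altp_eq1 n_artin _ st nst) => kk'; rewrite nk'; congr Some.
by apply/eqP; rewrite eqn_dvd k'k.
Qed.

(* With a single loop label, carried by [t], the orbit of [d0] is the path
   [d0 * A 0 - ... - d0 * A k.-1] with a loop at each end, both labelled by [x]. *)
Section Path.
Variable x : S.
Hypotheses (ls : label (g s ^ d0^-1) = None) (lt : label (g t ^ d0^-1) = Some x).
Notation L j := (if odd j then t else s).

Let genL j : g (L j) = if odd j then g t else g s.
Proof. by case: odd. Qed.

Let AS j : A j * g (L j) = A j.+1.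
Proof. by rewrite altpSr genL. Qed.

Let conjL j : g (L j) ^ (d0 * A j)^-1 = A (2 * j).+1%N ^ d0^-1.
Proof. by rewrite invgM conjgM genL altp_odd ?gen_sqr. Qed.

(** The step crosses the palindrome of length [2 * j + 1], which equals [g t] only if [k] divides
    [j + 1], while [g s] has no label. *)
Lemma path_label j : j.+1 < k -> label (g (L j) ^ (d0 * A j)^-1) = None.
Proof.
move=> lt_jk; rewrite conjL.
case: (pselect (A (2 * j).+1%N = g s)) => [->//|ns].
apply: label_dihedral ns _; first by exists (2 * j).+1%N.
move=> e; have: A (2 * j.+1)%N == 1.
  have -> : (2 * j.+1 = (2 * j).+2)%N by lia.
  by rewrite altpSr e oddS oddM /= gen_sqr.
by rewrite (altp_eq1 n_artin _ st nst) => /(dvdn_leq (ltn0Sn j)); rewrite leqNgt lt_jk.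
Qed.

Lemma path_up h j : j.+1 < k -> coset_step0 (L j) false (h, d0 * A j) = (h, d0 * A j.+1).
Proof. by move=> /path_label e; rewrite coset_step0_move // -mulgA AS. Qed.

Lemma path_down h j : j.+1 < k -> coset_step0 (L j) false (h, d0 * A j.+1) = (h, d0 * A j).
Proof.
move=> /path_label e; rewrite -AS mulgA.
by rewrite coset_step0_move ?conj_gen_step // mulg_genK.
Qed.

Lemma path_first h : coset_step0 t false (h, d0 * A 0) = (h * gam x, d0 * A 0).
Proof. by apply: coset_step0_loop; rewrite mulg1; apply/labelP. Qed.

(** The palindrome at the far end has length [2 * k - 1], hence equals [g t]: this is why both loops
    bear the same label. *)
Lemma path_last h :
  coset_step0 (L k.-1) false (h, d0 * A k.-1) = (h * gam x, d0 * A k.-1).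
Proof.
apply: coset_step0_loop; rewrite conjL; have -> : (2 * k.-1).+1%N = (2 * k - 1)%N by lia.
rewrite -(altp_swap (gen_sqr n s) (gen_sqr n t) full); last by lia.
by rewrite altpSr mul1g; apply/labelP.
Qed.

Lemma alt_catL j p q : alt (L j) (L j.+1) (p + q) =
  alt (L j) (L j.+1) p ++ alt (L (j + p)) (L (j + p).+1) q.
Proof. by rewrite alt_cat /= !oddD; case: (odd j); case: (odd p). Qed.

Lemma alt_consL j q : alt (L j) (L j.+1) q.+1 = (L j, false) :: alt (L j.+1) (L j.+2) q.
Proof. by rewrite /= negbK. Qed.

Lemma alt_consLV j q : alt (L j.+1) (L j) q.+1 = (L j.+1, false) :: alt (L j.+2) (L j.+1) q.
Proof. by rewrite /= negbK. Qed.

Lemma run_up h j q : j + q < k ->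
  run coset_step0 (alt (L j) (L j.+1) q) (h, d0 * A j) = (h, d0 * A (j + q)).
Proof.
elim: q j => [|q IHq] j lt_k; first by rewrite addn0.
have lt_jk : j.+1 < k by lia.
rewrite alt_consL -cat1s run_cat [run _ [:: _] _]/= path_up // IHq ?addSnnS //.
Qed.

Lemma run_down h j q : j + q < k ->
  run coset_step0 (alt (L (j + q).+1) (L (j + q)) q) (h, d0 * A (j + q)) = (h, d0 * A j).
Proof.
elim: q => [|q IHq] lt_k; first by rewrite addn0.
have lt_jk : (j + q).+1 < k by lia.
rewrite addnS alt_consLV -cat1s run_cat [run _ [:: _] _]/= negbK path_down //.
by have := IHq (ltnW lt_jk); rewrite /= !negbK.
Qed.

(** The walk goes up [k - 1 - i] steps, through the far loop and down [i] steps: the path is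
    reflected in its middle, and [h] is multiplied once. [run_backward] does the same through the
    near loop. *)
Lemma run_forward h i : i < k ->
  run coset_step0 (alt (L i) (L i.+1) k) (h, d0 * A i) = (h * gam x, d0 * A (k.-1 - i)).
Proof.
move=> lt_ik; have kE : k = (k.-1 - i + (1 + i))%N by lia.
have k1E : (i + (k.-1 - i) = k.-1)%N by lia.
rewrite [X in alt _ _ X]kE alt_catL run_cat run_up k1E; last by lia.
rewrite alt_catL run_cat [run _ (alt _ _ 1) _]/= path_last.
have := @run_down (h * gam x) (k.-1 - i) i; rewrite subnK; last by lia.
by rewrite addn1 /= negbK; apply; lia.
Qed.

Lemma run_backward h i : i < k ->
  run coset_step0 (alt (L i.+1) (L i) k) (h, d0 * A i) = (h * gam x, d0 * A (k.-1 - i)).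
Proof.
move=> lt_ik; have kE : k = (i + (1 + (k.-1 - i)))%N by lia.
have LE : L i = L i.+2 by rewrite /= negbK.
rewrite [X in alt _ _ X]kE LE alt_catL run_cat -LE.
have := @run_down h 0 i lt_ik; rewrite add0n => ->.
rewrite alt_catL run_cat.
have -> : L (i.+1 + i) = t by rewrite addSn /= oddD addbb.
rewrite [run _ (alt _ _ 1) _]/= path_first.
have := @run_up (h * gam x) 0 (k.-1 - i); rewrite add0n => <-; last by lia.
by rewrite addn1 addSn /= oddD addbb.
Qed.

Lemma run_one h u : D u -> min_rep (d0 * u) ->
  run coset_step0 (alt s t k) (h, d0 * u) = run coset_step0 (alt t s k) (h, d0 * u).
Proof.
move=> Du u_min; have [Ds Dt] := in_dihedral_gen n_artin st nst.
have ut := label_linv Dt lt u_min.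
have [i lt_ik ->] := in_dihedral_path n_artin st nst Du ut.
have := run_forward h lt_ik; have := run_backward h lt_ik.
by rewrite /=; case: odd => /= -> ->.
Qed.

End Path.
End Braid.

(** The cases count the loops at the minimal element [d0] of [d D]. With two, the orbit is a point
    and the relation is that of [G]; with one, it is a path; with none, every step is a move and the
    relation is that of [W]. *)
Lemma coset_step0_braid s t k h d : s != t -> n s t = Some k -> min_rep d ->
  run coset_step0 (alt s t k) (h, d) = run coset_step0 (alt t s k) (h, d).
Proof.
move=> st nst d_min; have ts : t != s by rewrite eq_sym.
have nts := label_sym n_artin st nst.
have [d0 [u [dE Du d0_min]]] := dihedral_min_rep n_artin st nst d.
rewrite dE in d_min *; have [Ds Dt] := in_dihedral_gen n_artin st nst.
case ls: (label (g s ^ d0^-1)) => [x|]; case lt: (label (g t ^ d0^-1)) => [y|].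
- have us := label_linv d0_min Ds ls d_min; have ut := label_linv d0_min Dt lt d_min.
  rewrite (in_dihedral_eq1 n_artin st nst Du us ut) mulg1.
  rewrite (run_both _ _ ls lt) (run_both _ _ lt ls).
  have [xy nxy] := label_both st nst ls lt.
  by rewrite (gam_braid xy nxy).
- have swapD r : in_dihedral t s r -> in_dihedral s t r.
    move=> [p ->]; elim: p => [|p IHp]; first exact: in_dihedral1.
    by rewrite altpSr; apply: (in_dihedralM n_artin st nst) => //; case: odd.
  have swapD' r : in_dihedral s t r -> in_dihedral t s r.
    have [Dt' Ds'] := in_dihedral_gen n_artin ts nts.
    move=> [p ->]; elim: p => [|p IHp]; first exact: in_dihedral1.
    by rewrite altpSr; apply: (in_dihedralM n_artin ts nts) => //; case: odd.
  apply/esym/(run_one ts nts _ lt ls) => //; last exact: swapD'.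
  by move=> r /swapD; apply: d0_min.
- exact: (run_one st nst d0_min ls lt).
- have memst a b j : a \in [:: s; t] -> b \in [:: s; t] ->
    all (fun p => p.1 \in [:: s; t]) (alt a b j).
    by elim: j a b => [|j IHj] a b //= ma mb; rewrite ma IHj.
  rewrite !(run_free st nst d0_min) // ?memst ?inE ?eqxx ?orbT //.
  by rewrite !cls_alt (gen_braid st nst).
Qed.

Lemma coset_step_braid s t k o : s != t -> n s t = Some k ->
  run coset_step (alt s t k) o = run coset_step (alt t s k) o.
Proof.
move=> st nst; rewrite !run_coset_step; case: ifP => // o_min.
by case: o o_min => h d; exact: coset_step0_braid.
Qed.

End CosetAction.

(** * Gluing copies of an Artin system along a cycle *)

Lemma perm_extension (S : finType) (A : {set S}) (phi : S -> S) :
  {in A &, injective phi} -> exists p : {perm S}, {in A, p =1 phi}.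
Proof.
move=> phi_inj; pose B := phi @: A.
have eqC : size (enum (~: A)) = size (enum (~: B)).
  rewrite -!cardE; apply/eqP; rewrite -(eqn_add2l #|A|) -{2}(card_in_imset phi_inj).
  by rewrite !cardsC.
(* Off [A], match the enumerations of the complements of [A] and of its image, which have the same
   size. *)
pose F s := if s \in A then phi s else nth s (enum (~: B)) (index s (enum (~: A))).
have FB s : s \notin A -> F s \in ~: B.
  move=> sA; rewrite /F (negbTE sA) -mem_enum mem_nth // -eqC index_mem mem_enum.
  by rewrite inE.
have F_inj : injective F.
  move=> s s'; case: (boolP (s \in A)) => sA; case: (boolP (s' \in A)) => s'A.
  - by rewrite /F sA s'A; apply: phi_inj.
  - by move=> e; have := FB _ s'A; rewrite -e {1}/F sA inE imset_f.
  - by move=> e; have := FB _ sA; rewrite e {1}/F s'A inE imset_f.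
  rewrite /F (negbTE sA) (negbTE s'A).
  have idx a : a \notin A -> index a (enum (~: A)) < size (enum (~: B)).
    by move=> aA; rewrite -eqC index_mem mem_enum inE.
  rewrite (set_nth_default s) ?idx // => /eqP; rewrite nth_uniq ?idx ?enum_uniq //.
  by move=> /eqP e; apply: (@index_inj _ s (enum (~: A))); rewrite ?mem_enum ?inE.
by exists (perm F_inj) => s sA; rewrite permE /F sA.
Qed.

Section CyclicGluing.
Variables (S : finType) (m : S -> S -> option nat) (m_artin : artin_system m).
Variables (A : {set S}) (p : {perm S}).
Hypothesis p_label : forall s s', s \in A -> s' \in A -> s != s' -> m (p s) (p s') = m s s'.
Variable N : nat.
Hypothesis NE : N.+2 = (2 * #[p])%N.
Local Open Scope ring_scope.
Import GRing.Theory.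
Notation pos := 'I_N.+2.
Implicit Types (s : S) (j : pos).

(* Going around the cycle of length [N.+2] from 0 to [j], forwards or backwards, the
   orbit of [s] under [p] can be followed inside [A]. *)
Definition reachable s (j : nat) : Prop :=
  (forall i, (i < j)%N -> iter i p s \in A) \/
  (forall i, (j <= i < N.+2)%N -> iter i p s \in A).

Definition chain s j : option S := if `[< reachable s j >] then Some (iter j p s) else None.

Lemma iter_perm_inj k : injective (iter k p).
Proof. by elim: k => [|k IHk] // s s' /perm_inj/IHk. Qed.

Lemma iter_order s k : iter (k * #[p]%g) p s = s.
Proof. by rewrite -permX mulnC expgM expg_order expg1n perm1. Qed.

Lemma iter_period s : iter N.+2 p s = s.
Proof. by rewrite NE iter_order. Qed.

Lemma chain0 s : chain s 0 = Some s.
Proof. by rewrite /chain asboolT //; left. Qed.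

Lemma chain_shift s j : s \in A -> chain (p s) j = chain s (j + 1).
Proof.
move=> sA; rewrite /chain -iterSr.
have [lt_j|ge_j] := ltnP j.+1 N.+2.
  have -> : (j + 1 : pos) = j.+1 :> nat by rewrite /= modn_small // addn1.
  congr (if _ then _ else _); apply: asbool_equiv_eq.
  split=> -[r|r]; [left|right|left|right] => i.
  - by case: i => // i lt_i; have := r i lt_i; rewrite -iterSr.
  - case: i => // i /andP[le_i lt_i]; rewrite iterSr; apply: r.
    by rewrite -ltnS le_i ltnW.
  - by move=> lt_i; rewrite -iterSr; apply: r.
  - move=> /andP[le_ji]; rewrite leq_eqVlt => /orP[/eqP[->]|lt_i].
      by rewrite -iterSr iter_period.
    by rewrite -iterSr; apply: r; rewrite ltnS le_ji.
(* Here [j + 1] wraps round to [0]; on the other side [s] is reached backwards from [p s], through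
   the single iterate [s]. *)
have jE : j = N.+1 :> nat by apply/eqP; rewrite eqn_leq -ltnS ltn_ord -ltnS.
have -> : j + 1 = 0 by apply: val_inj; rewrite /= jE addn1 modnn.
rewrite jE iter_period !asboolT //; first by left.
right=> i /andP[le_i lt_i]; have -> : i = N.+1 by apply/eqP; rewrite eqn_leq le_i -ltnS lt_i.
by rewrite -iterSr iter_period.
Qed.

Lemma iter_inv_forward s k : (#[p]%g <= k)%N -> (forall i, (i < k)%N -> iter i p s \in A) ->
  forall i, iter i p s \in A.
Proof.
move=> le_k sA i; rewrite (divn_eq i #[p]%g) addnC iterD iter_order.
by apply: sA; apply: leq_trans le_k; rewrite ltn_mod order_gt0.
Qed.

Lemma iter_inv_backward s k : (k + #[p]%g <= N.+2)%N ->
  (forall i, (k <= i < N.+2)%N -> iter i p s \in A) -> forall i, iter i p s \in A.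
Proof.
move=> le_k sA i; have := @iter_inv_forward (iter k p s) #[p]%g (leqnn _).
move=> /(_ _ (i + (k * #[p]%g - k)))%N; rewrite -iterD -addnA subnK; last first.
  by rewrite leq_pmulr // order_gt0.
rewrite iterD iter_order; apply=> i' lt_i'; rewrite -iterD; apply: sA.
by rewrite leq_addl /=; apply: leq_trans le_k; rewrite addnC ltn_add2l.
Qed.

Lemma iter_label s s' (j : nat) : s != s' -> 
  (forall i, (i < j)%N -> iter i p s \in A) -> (forall i, (i < j)%N -> iter i p s' \in A) ->
  m (iter j p s) (iter j p s') = m s s'.
Proof.
move=> ss'; elim: j => [|j IHj] // sA s'A.
have ne : iter j p s != iter j p s' by rewrite (inj_eq (@iter_perm_inj _)).
rewrite !iterS p_label ?sA ?s'A //.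
by apply: IHj => i lt_i; [apply: sA|apply: s'A]; apply: ltnW.
Qed.

Lemma iter_label_backward s s' (j : nat) : (j <= N.+2)%N -> s != s' ->
  (forall i, (j <= i < N.+2)%N -> iter i p s \in A) ->
  (forall i, (j <= i < N.+2)%N -> iter i p s' \in A) ->
  m (iter j p s) (iter j p s') = m s s'.
Proof.
move=> le_j ss' sA s'A; rewrite -[in RHS](iter_period s) -[in RHS](iter_period s').
have ne : iter j p s != iter j p s' by rewrite (inj_eq (@iter_perm_inj _)).
rewrite -(subnK le_j) !iterD (@iter_label (iter j p s)) // => i lt_i; rewrite -iterD.
  by apply: sA; rewrite leq_addl addnC -ltn_subRL.
by apply: s'A; rewrite leq_addl addnC -ltn_subRL.
Qed.

(** If both elements are followed in the same direction, the label is carried along. If not, one of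
    the two arcs has at least [#[p]] positions, so the element followed along it has its whole orbit
    in [A] and can be followed the other way too. This is why the cycle has twice the length of the
    order of [p]. *)
Lemma chain_label s s' j a b : s != s' -> chain s j = Some a -> chain s' j = Some b ->
  a != b /\ m a b = m s s'.
Proof.
rewrite /chain => ss'; case: asboolP => // rs [<-]; case: asboolP => // rs' [<-].
split; first by rewrite (inj_eq (@iter_perm_inj _)).
have le_j : (j <= N.+2)%N := ltnW (ltn_ord j).
have far : (#[p]%g <= j)%N \/ (j + #[p]%g <= N.+2)%N.
  by have := NE; case: (leqP #[p]%g j); [left|right; lia].
case: rs rs' => rs [] rs'.
- exact: iter_label.
- case: far => far.
    by apply: iter_label_backward => // i _; apply: iter_inv_forward far rs _.
  by apply: iter_label => // i _; apply: iter_inv_backward far rs' _.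
- case: far => far.
    by apply: iter_label_backward => // i _; apply: iter_inv_forward far rs' _.
  by apply: iter_label => // i _; apply: iter_inv_backward far rs _.
- exact: iter_label_backward.
Qed.

(** An element records its name in each copy, with [None] for the copies it does not lie in. Gluing
    thus becomes equality of functions rather than a quotient. *)
Definition glue := {ffun pos -> option S}.

Definition glue_emb (i : pos) s : glue := [ffun j => chain s (j - i)].

Lemma glue_emb_diag i s : glue_emb i s i = Some s.
Proof. by rewrite ffunE subrr chain0. Qed.

Lemma glue_emb_inj i : injective (glue_emb i).
Proof. by move=> s s' /(congr1 (fun x : glue => x i)); rewrite !glue_emb_diag => -[]. Qed.

Lemma glue_emb_shift i s : s \in A -> glue_emb (i + 1) (p s) = glue_emb i s.
Proof.
by move=> sA; apply/ffunP => j; rewrite !ffunE chain_shift // opprD addrA addrNK.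
Qed.

Definition glue_common (x y : glue) j : bool :=
  if (x j, y j) is (Some a, Some b) then a != b else false.

(** The label is read at some position where both names exist and differ; for two elements of one
    copy, [chain_label] makes the choice immaterial. *)
Definition glue_label (x y : glue) : option nat :=
  if [pick j | glue_common x y j] is Some j then
    if (x j, y j) is (Some a, Some b) then m a b else None
  else None.

Variant glue_label_spec (x y : glue) : option nat -> Prop :=
  | GlueNone of (forall j, ~~ glue_common x y j) : glue_label_spec x y None
  | GlueSome j a b of x j = Some a & y j = Some b & a != b : glue_label_spec x y (m a b).

Lemma glue_labelP x y : glue_label_spec x y (glue_label x y).
Proof.
rewrite /glue_label; case: pickP => [j|no]; last by left=> j; rewrite no.
rewrite /glue_common; case xj: (x j) => [a|] //; case yj: (y j) => [b|] // ab.
exact: GlueSome xj yj ab.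
Qed.

Lemma glue_labelC x y : glue_label x y = glue_label y x.
Proof.
have -> : glue_label x y = if [pick j | glue_common y x j] is Some j then
    if (x j, y j) is (Some a, Some b) then m a b else None else None.
  rewrite /glue_label; congr (if _ is Some j then _ else _); apply: eq_pick => j.
  by rewrite /glue_common; case: (x j) (y j) => [a|] [b|] //; rewrite eq_sym.
rewrite /glue_label; case: pickP => // j; rewrite /glue_common.
by case: (y j) (x j) => [a|] [b|] // ab; rewrite [RHS]m_artin.1.
Qed.

Lemma glue_artin : artin_system glue_label.
Proof.
split=> x y _; first exact: glue_labelC.
by case: glue_labelP => // j a b _ _ ab; exact: (m_artin.2 a b ab).
Qed.

Lemma glue_label_emb i s s' : s != s' -> glue_label (glue_emb i s) (glue_emb i s') = m s s'.
Proof.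
move=> ss'; case: glue_labelP => [/(_ i)|j a b]; first by rewrite /glue_common !glue_emb_diag ss'.
by rewrite !ffunE => ea eb _; have [] := chain_label ss' ea eb.
Qed.

End CyclicGluing.

(** * The embedding *)

Definition art_cox_rel (cox : bool) (S : finType) (m : S -> S -> option nat) :=
  if cox then coxeter_rel m else artin_rel m.

Lemma art_cox_relP cox (S : finType) (m : S -> S -> option nat) u v :
  art_cox_rel cox m u v <->
  artin_rel m u v \/ (cox /\ exists s, u = [:: (s, false); (s, false)] /\ v = [::]).
Proof.
case: cox; split=> /=.
- by case=> uv; [left|right].
- by case=> [uv|[_ uv]]; [left|right].
- by left.
- by case=> [|[]].
Qed.

Lemma alt_map (X Y : Type) (f : X -> Y) s t k :
  map (fun q => (f q.1, q.2)) (alt s t k) = alt (f s) (f t) k.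
Proof. by elim: k s t => [|k IHk] s t //=; rewrite IHk. Qed.

Section Embedding.
Variables (cox : bool) (S : finType) (m : S -> S -> option nat) (m_artin : artin_system m).
Variables (A : {set S}) (phi : S -> S) (p : {perm S}).
Hypothesis phi_label :
  forall s s', s \in A -> s' \in A -> s != s' -> m (phi s) (phi s') = m s s'.
Hypothesis p_phi : {in A, p =1 phi}.
Variable N : nat.
Hypothesis NE : N.+2 = (2 * #[p])%N.

Notation pos := 'I_N.+2.
Notation hrel := (hnn_rel (art_cox_rel cox m) (fun s => s \in A) phi).
Notation G := (presented hrel).
Notation T0 := (glue S N).
Notation n0 := (@glue_label S m N).
Notation W := (presented (coxeter_rel n0)).
Notation emb := (@glue_emb S A p N).

Let p_label s s' : s \in A -> s' \in A -> s != s' -> m (p s) (p s') = m s s'.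
Proof. by move=> sA s'A; rewrite !p_phi //; exact: phi_label. Qed.

Let n0_artin : artin_system n0. Proof. exact: glue_artin. Qed.

Let emb_shift i s : s \in A -> emb (i + 1)%R (phi s) = emb i s.
Proof. by move=> sA; rewrite -p_phi // glue_emb_shift. Qed.

Definition gam (s : S) : G := gen hrel (Some s).
Definition stable : G := gen hrel None.

Lemma gam_braid s t k : s != t -> m s t = Some k ->
  altp (gam s) (gam t) k = altp (gam t) (gam s) k.
Proof.
move=> st mst; rewrite -!cls_alt; apply: cls_rel; left.
exists (alt s t k), (alt t s k); rewrite /lift_word !alt_map; split=> //.
by apply/art_cox_relP; left; exists s, t, k.
Qed.

Lemma gam_sqr s : cox -> gam s * gam s = 1.
Proof.
move=> c; rewrite -cls_cat -cls_nil; apply: cls_rel; left.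
exists [:: (s, false); (s, false)], [::]; split=> //.
by apply/art_cox_relP; right; split=> //; exists s.
Qed.

Lemma gam_conj s : s \in A -> gam s * stable = stable * gam (phi s).
Proof.
move=> sA; have e : stable^-1 * (gam s * stable) = gam (phi s).
  transitivity (cls hrel [:: (None, true); (Some s, false); (None, false)]).
    by rewrite !cls_cons cls_nil mulg1.
  by apply: cls_rel; right; exists s.
by rewrite -e mulVKg.
Qed.

Let emb_braid i x y k : x != y -> n0 (emb i x) (emb i y) = Some k ->
  altp (gam x) (gam y) k = altp (gam y) (gam x) k.
Proof. by move=> xy; rewrite glue_label_emb //; exact: gam_braid. Qed.

(** * The target Artin system and its action *)

Definition target := option (T0 + pos).

Definition edge (j : pos) : {set T0} := [set emb j s | s in A].

(** The extra generator [None] commutes with all others, so that the label [2] occurs even if [A] is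
    empty; two generators [tau_i] give the infinite label. *)
Definition target_label (x y : target) : option nat :=
  match x, y with
  | Some (inl a), Some (inl b) => n0 a b
  | Some (inl a), Some (inr j) | Some (inr j), Some (inl a) =>
      if a \in edge j then Some 2 else None
  | Some (inr _), Some (inr _) => None
  | _, _ => Some 2
  end.

Lemma target_artin : artin_system target_label.
Proof.
split=> -[[a|i]|] [[b|j]|] //= ab.
- exact: glue_labelC.
- exact: (n0_artin.2 a b ab).
- by case: ifP.
- by case: ifP.
Qed.

Lemma is_target_label l : is_label target_label l <-> (is_label m l \/ l = Some 2 \/ l = None).
Proof.
split=> [[[[a|i]|] [[[b|j]|] [ab <-]]]|] /=; try by [auto|case: ifP; auto].
  case: glue_labelP => [|j s s' _ _ ss']; first by auto.
  by left; exists s, s'.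
move=> [[s [s' [ss' <-]]]|[->|->]].
- exists (Some (inl (emb 0%R s))), (Some (inl (emb 0%R s'))); split; last first.
    exact: glue_label_emb.
  by apply: contra ss' => /eqP[/glue_emb_inj->].
- by exists None, (Some (inr 0%R)).
- by exists (Some (inr 0%R)), (Some (inr 1%R)).
Qed.

Definition target_state := (G * pos * W)%type.

Definition target_act (x : target) (b : bool) (o : target_state) : target_state :=
  let: (h, i, d) := o in
  match x with
  | None => o
  | Some (inl a) => let r := coset_step (emb i) gam a b (h, d) in (r.1, i, r.2)
  | Some (inr j) =>
      if d == 1 then
        if i == j then (h * stable, (j + 1)%R, 1)
        else if i == (j + 1)%R then (h * stable^-1, j, 1) else o
      else o
  end.

Let succ_neq (j : pos) : ((j + 1)%R == j) = false.
Proof. by rewrite -GRing.subr_eq0 GRing.addrC GRing.addKr. Qed.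

Lemma act_stable_fwd j b h : target_act (Some (inr j)) b (h, j, 1) = (h * stable, (j + 1)%R, 1).
Proof. by rewrite /= !eqxx. Qed.

Lemma act_stable_bwd j b h :
  target_act (Some (inr j)) b (h, (j + 1)%R, 1) = (h * stable^-1, j, 1).
Proof. by rewrite /= !eqxx succ_neq. Qed.

Lemma act_stable_id j b h i d : ~~ [&& d == 1 & (i == j) || (i == (j + 1)%R)] ->
  target_act (Some (inr j)) b (h, i, d) = (h, i, d).
Proof. by rewrite /=; case: eqP => // _; case: eqP => // _; case: eqP. Qed.

Lemma act_stableK j b b' o : target_act (Some (inr j)) b' (target_act (Some (inr j)) b o) = o.
Proof.
case: o => [[h i] d].
have [/andP[/eqP-> /orP[]/eqP->]|no] := boolP [&& d == 1 & (i == j) || (i == (j + 1)%R)].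
- by rewrite act_stable_fwd act_stable_bwd mulgK.
- by rewrite act_stable_bwd act_stable_fwd mulgVK.
- by rewrite !act_stable_id.
Qed.

Lemma actK x b o : target_act x (~~ b) (target_act x b o) = o.
Proof.
case: x => [[a|j]|] /=; [|exact: act_stableK|by case: o => [[]]].
case: o => [[h i] d] /=.
by rewrite -surjective_pairing coset_stepK //; exact: glue_emb_inj.
Qed.

Lemma act_emb1 (i : pos) s b h :
  target_act (Some (inl (emb i s))) b (h, i, 1) = (h * (if b then (gam s)^-1 else gam s), i, 1).
Proof. by rewrite /= coset_step_loop //; exact: glue_emb_inj. Qed.

Lemma act_commute a j o : a \in edge j ->
  target_act (Some (inl a)) false (target_act (Some (inr j)) false o) =
  target_act (Some (inr j)) false (target_act (Some (inl a)) false o).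
Proof.
move=> /imsetP[s sA ->]; case: o => [[h i] d].
have [/andP[/eqP-> /orP[]/eqP->]|no] := boolP [&& d == 1 & (i == j) || (i == (j + 1)%R)].
- rewrite act_stable_fwd -{1}(emb_shift j sA) !act_emb1 act_stable_fwd.
  by rewrite -!mulgA gam_conj.
- rewrite act_stable_bwd -{2}(emb_shift j sA) !act_emb1 act_stable_bwd.
  by rewrite -!mulgA -[gam (phi s)](mulKg stable) -gam_conj // -!mulgA mulgV mulg1.
rewrite [X in target_act _ _ X = _]act_stable_id //.
case e: (target_act (Some (inl (emb j s))) false (h, i, d)) => [[h' i'] d'].
have ii' : i' = i by move/(congr1 (fun o => o.1.2)): e.
rewrite act_stable_id //; apply: contra no => /andP[/eqP d1]; rewrite ii' => ij.
(* At position [j] or [j + 1] the generator belongs to the current copy, so it fixes the coset of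
   [1]. A step ending there would therefore have started there, which is excluded. *)
have [x ax] : exists x, emb j s = emb i x.
  case/orP: (ij) => /eqP ->; first by exists s.
  by exists (phi s); rewrite emb_shift.
have := actK (Some (inl (emb j s))) false (h, i, d).
by rewrite e ax ii' d1 act_emb1 => -[_ <-]; rewrite eqxx.
Qed.

Lemma run_act_emb v h i d : run target_act (map (fun q => (Some (inl q.1), q.2)) v) (h, i, d) =
  let r := run (coset_step (emb i) gam) v (h, d) in (r.1, i, r.2).
Proof.
elim: v h d => [|[a b] v IHv] h d //; rewrite [map _ _]/= [run _ _ _]/= -/(run _ _ _).
by rewrite IHv -surjective_pairing.
Qed.

Lemma act_None b o : target_act None b o = o.
Proof. by case: o => [[]]. Qed.

Lemma run_alt2 x y o : run target_act (alt x y 2) o = target_act y false (target_act x false o).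
Proof. by []. Qed.

Lemma act_weq u v : weq (art_cox_rel cox target_label) u v -> run target_act u =1 run target_act v.
Proof.
apply: run_weq; first exact: actK.
move=> u' v' /art_cox_relP[[x [y [k [xy nxy -> ->]]]]|[c [x [-> ->]]]] o; last first.
  case: x => [[a|j]|] /=; [|exact: act_stableK|by case: o => [[]]].
  have sym s : (gam s)^-1 = gam s by apply: mulg1_eq; rewrite gam_sqr.
  rewrite -[RHS](actK (Some (inl a)) false) [~~ _]/=; set o' := target_act _ _ o.
  case: o' => [[h i] d] /=; rewrite /coset_step /coset_step0.
  by case: label => // x; rewrite sym.
case: x y xy nxy => [[a|i]|] [[b|j]|] //= xy; try by case=> <-; rewrite !run_alt2 !act_None.
- move=> nab; rewrite -!(alt_map (fun a => Some (inl a))); case: o => [[h i] d].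
  by rewrite !run_act_emb (coset_step_braid n0_artin (@glue_emb_inj _ _ _ _ i) (@emb_braid i)).
- by case: ifP => // aj [<-]; rewrite !run_alt2 act_commute.
- by case: ifP => // bi [<-]; rewrite !run_alt2 act_commute.
Qed.

(** * Unrolling words around the cycle *)

Definition move_pos (x : option S) (b : bool) (i : pos) : pos :=
  if x is Some _ then i else if b then (i - 1)%R else (i + 1)%R.

Lemma moveK x b i : move_pos x (~~ b) (move_pos x b i) = i.
Proof. by case: x b => [s|] [] //=; rewrite ?GRing.addrK ?GRing.subrK. Qed.

Lemma run_move_weq u v : weq hrel u v -> run move_pos u =1 run move_pos v.
Proof.
apply: run_weq; first exact: moveK.
have lift_id w i : run move_pos (@lift_word S w) i = i by elim: w => // -[].
move=> u' v' [[u0 [v0 [_ -> ->]]]|[s [_ -> ->]]] i; first by rewrite !lift_id.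
by rewrite /= GRing.subrK.
Qed.

Lemma run_move_add w i : run move_pos w i = (i + run move_pos w 0)%R.
Proof.
have shift v i' j : run move_pos v (i' + j)%R = (i' + run move_pos v j)%R.
  elim: v j => [|[[s|] [] ] v IHv] j //; rewrite /= -!/(run _ _ _) ?IHv //.
    by rewrite -GRing.addrA IHv.
  by rewrite -GRing.addrA IHv.
by rewrite -{1}[i]GRing.addr0 shift.
Qed.

(* The letters [t^{+-1}] move the position around the cycle, and a letter [s] read at
   position [i] becomes the copy [emb i s]. *)
Fixpoint unroll (i : pos) (w : word (option S)) : word target :=
  match w with
  | [::] => [::]
  | (Some s, b) :: w' => (Some (inl (emb i s)), b) :: unroll i w'
  | (None, false) :: w' => (Some (inr i), false) :: unroll (i + 1)%R w'
  | (None, true) :: w' => (Some (inr (i - 1)%R), true) :: unroll (i - 1)%R w'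
  end.

Lemma unroll_cat i u v : unroll i (u ++ v) = unroll i u ++ unroll (run move_pos u i) v.
Proof. by elim: u i => [|[[s|] []] u IHu] i //=; rewrite IHu. Qed.

Lemma run_unroll w h i : run target_act (unroll i w) (h, i, 1) =
  (h * cls hrel w, run move_pos w i, 1).
Proof.
elim: w h i => [|[[s|] b] w IHw] h i; first by rewrite mulg1.
  by rewrite [unroll _ _]/= !run_cons act_emb1 IHw cls_cons mulgA.
case: b; rewrite [unroll _ _]/= !run_cons.
  have := act_stable_bwd (i - 1)%R true h; rewrite GRing.subrK => ->.
  by rewrite IHw cls_cons mulgA.
by rewrite act_stable_fwd IHw cls_cons mulgA.
Qed.

Lemma unroll_lift i w : unroll i (lift_word w) = map (fun q => (Some (inl (emb i q.1)), q.2)) w.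
Proof. by elim: w => [|[s b] w IHw] //=; rewrite IHw. Qed.

Lemma unroll_weq u v : weq hrel u v -> forall i,
  weq (art_cox_rel cox target_label) (unroll i u) (unroll i v).
Proof.
elim=> {u v}.
- by move=> u i; exact: weq_refl.
- by move=> u v _ IHu i; exact/weq_sym.
- by move=> u v w _ IHu _ IHv i; apply: weq_trans (IHv i).
- move=> u v [[u0 [v0 [uv -> ->]]]|[s [sA -> ->]]] i.
    rewrite !unroll_lift; apply: weq_rel; apply/art_cox_relP.
    case/art_cox_relP: uv => [[s [t [k [st mst -> ->]]]]|[c [s [-> ->]]]]; last first.
      by right; split=> //; exists (Some (inl (emb i s))).
    left; rewrite !(alt_map (fun s => Some (inl (emb i s)))).
    exists (Some (inl (emb i s))), (Some (inl (emb i t))), k; split=> //.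
      by apply: contra st => /eqP[/glue_emb_inj->].
    by rewrite /= glue_label_emb.
  (* The letter [t^-1] moves from [i] to [i - 1], where [s] is the same glued element as [phi s] at
     [i]: the HNN relation becomes a commutation with [tau_(i-1)]. *)
  have emb_i : emb (i - 1)%R s = emb i (phi s) by rewrite -emb_shift // GRing.subrK.
  rewrite /= -emb_i; apply/clsP.
  pose e : target := Some (inl (emb (i - 1)%R s)); pose j : target := Some (inr (i - 1)%R).
  rewrite -/e -/j.
  have ej : gen (art_cox_rel cox target_label) e * gen (art_cox_rel cox target_label) j =
            gen (art_cox_rel cox target_label) j * gen (art_cox_rel cox target_label) e.
    rewrite -!cls_cat; apply: cls_rel; apply/art_cox_relP; left.
    by exists e, j, 2; split=> //=; rewrite imset_f.
  by rewrite !cls_cons cls_nil !mulg1 ej mulKg.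
- move=> [s|] [] i /=; rewrite ?GRing.addrK; try exact: weq_cancel _ _ true;
  exact: weq_cancel _ _ false.
- move=> u u' v v' uu' IHu _ IHv i; rewrite !unroll_cat (run_move_weq uu').
  by apply: weq_cat.
Qed.

Definition base_words (w : word (option S)) : Prop := run move_pos w 0%R = 0%R.

Lemma base_words_finite_index : finite_index hrel base_words.
Proof.
have sub : is_subgroup hrel base_words.
  split=> [//|u v Hu Hv|u Hu|u v uv Hu]; rewrite /base_words.
  - by rewrite run_cat Hu.
  - have := run_move_weq (weq_mulwV hrel u) 0%R.
    by rewrite run_cat Hu.
  - by rewrite -(run_move_weq uv).
split=> //; exists N.+2, (fun i => nseq i (None, false)) => w.
have move_nseq k : run move_pos (nseq k (None, false)) 0%R = (k%:R)%R.
  elim: k => [|k IHk] //; rewrite [RHS]GRing.mulrSr -IHk.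
  have -> : nseq k.+1 (None, false) = nseq k (None, false) ++ nseq 1 (@None S, false).
    by rewrite -nseqD addn1.
  by rewrite run_cat.
(* The coset representatives are the powers [t^i], and [t^-i w] ends at position [0]. *)
pose i := run move_pos w 0%R; exists i, (winv (nseq i (None, false)) ++ w); split.
  have := run_move_weq (weq_mulwV hrel (nseq i (None, false))) 0%R.
  rewrite /base_words !run_cat move_nseq natr_Zp run_move_add => e.
  by rewrite run_move_add -/i GRing.addrC.
rewrite catA -{1}[w]cat0s; apply: weq_cat; last exact: weq_refl.
exact/weq_sym/weq_mulwV.
Qed.

Lemma base_words_embed : embeds_into hrel base_words (art_cox_rel cox target_label).
Proof.
exists (unroll 0%R); split=> [u v _ _ uv|u v Hu _|u v _ _ /act_weq uv].
- exact: unroll_weq.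
- by rewrite unroll_cat Hu; exact: weq_refl.
(* From the base state, the first component reached is the class of the word itself. *)
apply/clsP; have := uv (1, 0%R, 1); rewrite !run_unroll => -[e _].
by move: e; rewrite !mul1g.
Qed.

End Embedding.

Lemma hnn_virtually_embeds (cox : bool) (S : finType) (m : S -> S -> option nat)
    (A : {set S}) (phi : S -> S) :
  artin_system m -> {in A &, injective phi} ->
  (forall s s', s \in A -> s' \in A -> s != s' -> m (phi s) (phi s') = m s s') ->
  let hrel := hnn_rel (art_cox_rel cox m) (fun s => s \in A) phi in
  exists H, finite_index hrel H /\
    exists (T : finType) (n : T -> T -> option nat),
      [/\ artin_system n,
          (forall l, is_label n l <-> (is_label m l \/ l = Some 2 \/ l = None)) &
          embeds_into hrel H (art_cox_rel cox n)].
Proof.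
move=> m_artin phi_inj phi_label hrel; have [p p_phi] := perm_extension phi_inj.
(* The cycle length is at least [2]; written as a double successor, it makes the positions a ring of
   integers modulo that length. *)
have NE : (2 * #[p] - 2).+2 = (2 * #[p])%N by have := order_gt0 p; lia.
exists (@base_words S (2 * #[p] - 2)); split; first exact: base_words_finite_index.
exists (target S (2 * #[p] - 2)), (@target_label S m A p (2 * #[p] - 2)); split.
- exact: target_artin.
- exact: (is_target_label phi_label p_phi NE).
- exact: (base_words_embed cox m_artin phi_label p_phi NE).
Qed.

Theorem theorem1 (S : finType) (m : S -> S -> option nat)
  (hm : artin_system m) (S' S'' : {set S}) (phi : S -> S)
  (hphi : label_preserving m S' S'' phi) :
  (exists H : word (option S) -> Prop,
     finite_index (artin_hnn_rel m S' phi) H /\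
     exists (T : finType) (n : T -> T -> option nat),
       [/\ artin_system n,
           (forall l, is_label n l <-> (is_label m l \/ l = Some 2 \/ l = None)) &
           embeds_into (artin_hnn_rel m S' phi) H (artin_rel n)]) /\
  (exists H : word (option S) -> Prop,
     finite_index (coxeter_hnn_rel m S' phi) H /\
     exists (T' : finType) (n' : T' -> T' -> option nat),
       [/\ artin_system n',
           (forall l, is_label n' l <-> (is_label m l \/ l = Some 2 \/ l = None)) &
           embeds_into (coxeter_hnn_rel m S' phi) H (coxeter_rel n')]).
Proof.
case: hphi => phi_inj _ phi_label; split.
  exact: (@hnn_virtually_embeds false _ _ _ _ hm phi_inj phi_label).
exact: (@hnn_virtually_embeds true _ _ _ _ hm phi_inj phi_label).
Qed.
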